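(* Let $G$ be a finite group and $H$ a subgroup of $G$. Suppose that either $H$ is a $2$-group or at least one of $|H|$ and $|G:H|$ is odd. Then $H$ is a perfect code of $G$ if and only if for any $x\in N_{G}(H)$, $x^{2}\in H$ implies $(xh)^{2}=1$ for some $h\in H$.
   Context: For a finite group $G$ with identity $1$ and a subset $S\subseteq G\setminus\{1\}$ with $S^{-1}=S$ (possibly $S=\emptyset$), the Cayley graph $\mathrm{Cay}(G,S)$ has vertex set $G$, with $x,y$ adjacent if and only if $yx^{-1}\in S$. A perfect code in a graph $\Gamma$ with vertex set $V$ is a subset $C\subseteq V$ such that no two vertices of $C$ are adjacent and every vertex in $V\setminus C$ is adjacent to exactly one vertex in $C$. A subset (in particular a subgroup) $C$ of $G$ is called a perfect code of $G$ if there exists such an $S$ for which $C$ is a perfect code in $\mathrm{Cay}(G,S)$. $N_G(H)$ denotes the normalizer of $H$ in $G$. A $2$-group is a finite group whose order is a power of $2$. *)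

(* Defs.v *)
From mathcomp Require Import all_boot all_fingroup all_solvable.
Set Implicit Arguments.
Unset Strict Implicit.
Unset Printing Implicit Defensive.

Local Open Scope group_scope.

(* A finite graph is given by its vertex set V inside a finite type and its
   adjacency relation e (only relevant on V). *)
Definition graph_perfect_code (T : finType) (V : {set T}) (e : rel T)
    (C : {set T}) : Prop :=
  [/\ C \subset V,
      forall x y, x \in C -> y \in C -> ~~ e x y
    & forall v, v \in V :\: C -> #|[set c in C | e v c]| = 1%N].

(* The inverse on {set gT} is pointwise, and G^# is G minus the identity. *)
Definition connection_set (gT : finGroupType) (G S : {set gT}) : Prop :=
  S \subset G^# /\ S^-1 = S.

Definition cayley_adj (gT : finGroupType) (S : {set gT}) : rel gT :=
  fun x y => y * x^-1 \in S.

Definition perfect_code (gT : finGroupType) (G C : {set gT}) : Prop :=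
  exists S : {set gT},
    connection_set G S /\ graph_perfect_code G (cayley_adj S) C.

(* Main.v *)
Require Import Defs.
From mathcomp Require Import all_boot all_fingroup all_solvable.

(** Put T = S together with 1.  In Cay(G, S) the vertices of H adjacent to v
    are the c in H with c v^-1 in S, so H is a perfect code exactly when some
    inverse-closed T meets every right coset of H in G once.

    Necessity holds for every subgroup.  If x normalises H and x^2 lies in H,
    then the coset H x^-1 = x H is stable under inversion, so its unique
    element in T is its own inverse ([perfect_code_normalizer]).

    For sufficiency, take a maximal inverse-closed T meeting each right coset
    at most once, and suppose that it misses H y; put D = H y H.  For any
    right coset H z inside D^-1 there is s in H y with s^-1 in H z
    ([dcoset_inv_rcoset]), so T can be enlarged by s and s^-1 as soon as H z
    is also missed and differs from H y.  It can also be enlarged by any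
    element of H y of square 1, and conjugating by H shows that H y has such
    an element if D has.  So it is enough to find a second missed coset when D
    has no element of square 1 ([missed_rcoset]).  As T is inverse-closed, it
    meets as many cosets in D^-1 as in D; this settles the case D <> D^-1.
    If D = D^-1, then T and D share an even number of elements, which pair off
    with their inverses, and a lone missed coset would make the number
    |H : H :&: H^y| of cosets in D odd.  Hence H is a perfect code as soon as
    H y H has an element of square 1 whenever y^2 is in H and this index is
    odd ([perfect_code_of_dcoset_involutions]).

    Each alternative on H provides that element.  If H is a 2-group, an odd
    index must be 1, so y normalises H and the normaliser condition applies.
    If |H| is odd, y^|H| works.  If |G : H| is odd, then so is
    |G : H :&: H^y|; as y normalises H :&: H^y and has its square in it, y is
    in H, and H y H contains 1. *)
Local Open Scope group_scope.

Set Implicit Arguments.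
Unset Strict Implicit.

(** Without elements of square 1, inversion pairs off the elements of A. *)
Lemma even_card_invg_closed (gT : finGroupType) (A : {set gT}) :
  A^-1 = A -> (forall t, t \in A -> t ^+ 2 != 1) -> ~~ odd #|A|.
Proof.
have [n] := ubnP #|A|; elim: n A => // n IHn A /ltnSE leAn AV noA.
have [-> | [t tA]] := set_0Vmem A; first by rewrite cards0.
have tVA : t^-1 \in A by rewrite -mem_invg AV.
have tVt : t^-1 != t.
  by apply: contra (noA t tA) => /eqP tE; rewrite expgS expg1 -{1}tE mulVg.
have cardA : #|A| = #|A :\ t :\ t^-1|.+2.
  by rewrite (cardsD1 t) tA (cardsD1 t^-1 (A :\ t)) !inE tVt tVA.
rewrite cardA /= negbK; apply: IHn.
- by rewrite -ltnS -cardA ltnW.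
- apply/setP=> u; rewrite !inE -mem_invg AV.
  by rewrite !(can2_eq invgK invgK) invgK andbCA.
- by move=> u; rewrite !inE => /and3P[_ _]; apply: noA.
Qed.

(** * Double cosets of a subgroup *)

Section DoubleCosets.

Variables (gT : finGroupType) (H : {group gT}).
Implicit Types y z s : gT.

Lemma dcosetP y z :
  reflect (exists a b, [/\ a \in H, b \in H & z = a * y * b])
          (z \in H :* y * H).
Proof.
apply: (iffP mulsgP) => [[_ b /rcosetP[a aH ->] bH ->] | [a [b [aH bH ->]]]].
  by exists a, b.
by exists (a * y) b; rewrite ?mem_rcoset ?mulgK.
Qed.

Lemma rcoset_sub_dcoset y : H :* y \subset H :* y * H.
Proof. by rewrite mulG_subl. Qed.

Lemma dcoset_eq y z : z \in H :* y * H -> H :* z * H = H :* y * H.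
Proof.
case/dcosetP=> a [b [aH bH ->]].
by rewrite !rcosetM (rcoset_id aH) -(mulgA _ [set b]) lcoset_id.
Qed.

Lemma dcosetV y : (H :* y * H)^-1 = H :* y^-1 * H.
Proof. by rewrite invMg invg_rcoset invGid mulgA. Qed.

(** The index is the number of right cosets of H in H y H: up to
    translation, H y H is the product of the subgroups H^y and H. *)
Lemma card_dcoset y : #|H :* y * H| = (#|H| * #|H : H :&: H :^ y|)%N.
Proof.
have -> : H :* y * H = y *: (H :^ y * H) by rewrite conjsgE -!mulgA lcosetKV.
rewrite card_lcoset; apply/eqP.
rewrite -(eqn_pmul2r (cardG_gt0 (H :&: H :^ y))) -mulnA (mulnC #|H : _|).
rewrite Lagrange ?subsetIl //; have /= := mul_cardG (H :^ y) H.
by rewrite cardJg setIC => ->.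
Qed.

(** This is the freedom on which the construction rests: a right coset in
    H y H and a right coset in its inverse can always be joined by a pair of
    mutually inverse elements, since each right coset in H y^-1 H contains
    y^-1 b for some b in H. *)
Lemma dcoset_inv_rcoset y z : z \in (H :* y * H)^-1 ->
  exists2 s, s \in H :* y & s^-1 \in H :* z.
Proof.
rewrite inE => /dcosetP[a [b [aH bH zE]]].
exists (a * y); first by rewrite mem_rcoset mulgK.
by rewrite mem_rcoset zE mulKg.
Qed.

End DoubleCosets.

(** * Inverse-closed partial transversals *)

Section PartialTransversals.

Variables (gT : finGroupType) (G H : {group gT}).
Hypothesis sHG : H \subset G.
Implicit Types (y z s t : gT) (A D T : {set gT}).

(** Boolean, so that one can choose a T maximal for inclusion.  The set of
    elements in the cosets met by T is H * T. *)
Definition inv_partial_transversal T :=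
  [&& T \subset G, T^-1 == T
    & [forall t in T, forall u in T, (u * t^-1 \in H) ==> (u == t)]].

Lemma inv_partial_transversalP T :
  reflect [/\ T \subset G, T^-1 = T
            & {in T &, forall t u, u * t^-1 \in H -> u = t}]
          (inv_partial_transversal T).
Proof.
apply: (iffP and3P) => [[sTG /eqP TV /forall_inP Tinj] | [sTG TV Tinj]].
  by split=> // t u tT uT /(implyP (forall_inP (Tinj t tT) u uT))/eqP.
split=> //; first exact/eqP.
by do 2!apply/forall_inP=> ? ?; apply/implyP=> ?; apply/eqP/Tinj.
Qed.

Lemma card_mulG_partial T A : inv_partial_transversal T -> A \subset T ->
  #|H * A| = (#|H| * #|A|)%N.
Proof.
case/inv_partial_transversalP=> _ _ Tinj /subsetP sAT.
have -> : H * A = [set p.1 * p.2 | p in setX H A].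
  apply/setP=> z; apply/mulsgP/imsetP => [[a t aH tA ->] | [[a t]]].
    by exists (a, t); rewrite // inE aH.
  by case/setXP=> aH tA ->; exists a t.
rewrite -cardsX card_in_imset //.
move=> [a t] [b u] /setXP[/= aH tA] /setXP[/= bH uA] /= eq_at.
have tu : u = t.
  apply: Tinj (sAT _ tA) (sAT _ uA) _.
  have -> : u = b^-1 * (a * t) by rewrite eq_at mulKg.
  by rewrite mulgA mulgK groupM ?groupV.
by move: eq_at; rewrite tu => /mulIg->.
Qed.

(** Both ways of enlarging T: by one element of square 1, or by a pair of
    inverse elements lying in two different missed cosets. *)
Lemma inv_partial_transversalU T s :
    inv_partial_transversal T -> s \in G -> s \notin H * T ->
    s^-1 \notin H * T -> (s^-1 = s \/ s^-1 \notin H :* s) ->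
  inv_partial_transversal (T :|: [set s; s^-1]).
Proof.
case/inv_partial_transversalP=> sTG TV Tinj sG sHT sVHT sVs.
have out t u : t \in T -> u \notin H * T -> u * t^-1 \notin H.
  by move=> tT; apply: contra => utH; rewrite -[u](mulgKV t) mem_mulg.
have out' t u : t \in T -> u \notin H * T -> t * u^-1 \notin H.
  by move=> tT uHT; rewrite -groupV invMg invgK out.
apply/inv_partial_transversalP; split.
- by rewrite !subUset sTG !sub1set groupV sG.
- rewrite invUg TV; congr (_ :|: _); apply/setP=> u; rewrite !inE.
  by rewrite !(can2_eq invgK invgK) invgK orbC.
have pair t u : t \in [set s; s^-1] -> u \in [set s; s^-1] ->
  u * t^-1 \in H -> u = t.
- case: sVs => [sV | sVs]; first by rewrite sV !inE !orbb => /eqP-> /eqP->.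
  move: sVs; rewrite mem_rcoset => sVs.
  case/set2P=> -> /set2P[] -> //; first by rewrite (negPf sVs).
  by rewrite -groupV invMg invgK (negPf sVs).
have outp u : u \in [set s; s^-1] -> u \notin H * T by case/set2P=> ->.
move=> t u /setUP[tT | tp] /setUP[uT | up]; first exact: Tinj.
- by rewrite (negPf (out _ _ tT (outp _ up))).
- by rewrite (negPf (out' _ _ uT (outp _ tp))).
- exact: pair.
Qed.

(** The element representing H itself has to leave the connection set, and
    the others stay.  The neighbour of v in H is read off from the
    factorisation of v^-1 in H * T. *)
Lemma perfect_code_of_transversal T :
  inv_partial_transversal T -> G \subset H * T -> perfect_code G H.
Proof.
case/inv_partial_transversalP=> sTG TV Tinj sGHT.
exists (T :\: H); split; first split.
- apply/subsetP=> t; rewrite !inE => /andP[tH /(subsetP sTG)->].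
  by rewrite andbT; apply: contraNneq tH => ->.
- by apply/setP=> t; rewrite !inE groupV -mem_invg TV.
split=> // [x y xH yH | v].
  by rewrite /cayley_adj inE groupM ?groupV.
case/setDP=> vG vH.
have /mulsgP[h t hH tT vE] : v^-1 \in H * T by rewrite (subsetP sGHT) ?groupV.
have vVE k : k * v^-1 = k * h * t by rewrite vE mulgA.
have tH : t \notin H by rewrite -(groupMl _ hH) -vE groupV.
apply/eqP/cards1P; exists h^-1; apply/setP=> c; rewrite !inE /cayley_adj.
rewrite inE vVE; apply/and3P/eqP=> [[cH _ chT] | ->].
  have : c * h * t = t by apply: Tinj; rewrite ?mulgK ?groupM.
  by move/(canRL (mulgK _)); rewrite mulgV => /(canRL (mulgK _)); rewrite mul1g.
by rewrite groupV hH mulVg mul1g.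
Qed.

Hypothesis invol_dcoset : forall y, y \in G -> y ^+ 2 \in H ->
  odd #|H : H :&: H :^ y| -> exists2 s, s \in H :* y * H & s ^+ 2 = 1.

(** Counting: otherwise T meets every coset in D^-1 except perhaps H y.  It
    meets as many cosets in D^-1 as in D, where it misses H y; so H y lies in
    D^-1, hence D = D^-1 consists of H y and the cosets met by T.  Their number
    is odd, since T :&: D pairs off under inversion, and then [invol_dcoset]
    contradicts [noinv]. *)
Lemma missed_rcoset T y :
    inv_partial_transversal T -> y \in G -> y \notin H * T ->
    (forall s, s \in H :* y * H -> s ^+ 2 != 1) ->
  exists z, [/\ z \in (H :* y * H)^-1, z \notin H * T & z \notin H :* y].
Proof.
move=> pT yG yHT noinv; set D := H :* y * H in noinv *.
have [sTG TV Tinj] := inv_partial_transversalP _ pT.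
have [/existsP[z /and3P[*]] | /existsPn sDV] :=
  boolP [exists z, [&& z \in D^-1, z \notin H * T & z \notin H :* y]].
- by exists z.
exfalso.
have card_HT E : #|H * (T :&: E)| = (#|H| * #|T :&: E|)%N.
  by rewrite (card_mulG_partial pT) ?subsetIl.
have HyT : [disjoint H :* y & H * T].
  rewrite disjoint_subset; apply/subsetP=> _ /rcosetP[a aH ->]; rewrite inE.
  apply: contra yHT => /mulsgP[b t bH tT E].
  by rewrite -[y](mulKg a) E mulgA mem_mulg ?groupM ?groupV.
have leHD : (#|H| * #|T :&: D|.+1 <= #|D|)%N.
  rewrite mulnS -card_HT -(card_rcoset H y).
  have : #|(H :* y) :&: (H * (T :&: D))| = 0.
    apply/eqP; rewrite cards_eq0 setI_eq0.
    by apply: disjointWr HyT; rewrite mulgS ?subsetIl.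
  move=> card0; rewrite -cardsUI card0 addn0.
  apply: subset_leq_card; rewrite subUset rcoset_sub_dcoset /=.
  have HD : H * D = D by rewrite /D !mulgA mulGid.
  by rewrite -{2}HD mulgS ?subsetIr.
have coverDV z : z \in D^-1 -> z \in H * (T :&: D^-1) :|: H :* y.
  move=> zDV; have := sDV z; rewrite zDV /= negb_and !negbK.
  case/orP=> [/mulsgP[h t hH tT zE] | zy]; apply/setUP; last by right.
  left; rewrite zE mem_mulg //; apply/setIP; split=> //.
  have -> : D^-1 = H * D^-1 by rewrite dcosetV !mulgA mulGid.
  by rewrite -[t](mulKg h) -zE mem_mulg ?groupV.
have cardTDV : #|T :&: D^-1| = #|T :&: D|.
  by rewrite -card_invg invIg invgK TV.
have cardDV : #|D^-1| = #|D| by rewrite card_invg.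
have [yDV | yDV] := boolP (y \in D^-1); last first.
  suff : (#|D| <= #|H| * #|T :&: D|)%N.
    by move/(leq_trans leHD); rewrite leq_pmul2l ?ltnn.
  rewrite -cardTDV -card_HT -cardDV subset_leq_card //.
  apply/subsetP=> z zDV; case/setUP: (coverDV z zDV) => // zy.
  case/negP: yDV; rewrite rcoset_sym in zy.
  move: zDV; rewrite /D dcosetV => /dcoset_eq <-.
  exact: (subsetP (rcoset_sub_dcoset _ _)).
have DV : D^-1 = D by move: (yDV); rewrite /D dcosetV => /dcoset_eq <-.
have cardD : #|D| = (#|H| * #|T :&: D|.+1)%N.
  apply/eqP; rewrite eqn_leq leHD andbT mulnS addnC -card_HT -(card_rcoset H y).
  rewrite -cardsUI -{1}DV; apply: leq_trans (leq_addr _ _).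
  by apply: subset_leq_card; apply/subsetP=> z /coverDV; rewrite DV.
have oddD : odd #|H : H :&: H :^ y|.
  move/eqP: cardD; rewrite card_dcoset eqn_pmul2l // => /eqP->.
  apply: even_card_invg_closed; first by rewrite invIg TV DV.
  by move=> t /setIP[_ /noinv].
(* y^-1 = a y b gives (b y)^2 = b a^-1 in H, and H^(b y) = H^y. *)
move: yDV; rewrite inE => /dcosetP[a [b [aH bH yV]]].
have [|||s] := @invol_dcoset (b * y).
- by rewrite groupM // (subsetP sHG).
- have -> : (b * y) ^+ 2 = b * a^-1 * (a * y * b) * y.
    by rewrite expgS expg1 !mulgA mulgKV.
  by rewrite -yV mulgKV groupM ?groupV.
- by rewrite conjsgM conjGid.
rewrite (@dcoset_eq _ _ y) => [/noinv/eqP // |].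
by apply/dcosetP; exists b, 1; rewrite mulg1.
Qed.

Lemma perfect_code_of_dcoset_involutions : perfect_code G H.
Proof.
have [T /maxsetP[pT maxT]] : {T | maxset inv_partial_transversal T}.
  apply: ex_maxset; exists set0; apply/inv_partial_transversalP; split.
  - exact: sub0set.
  - by apply/setP=> t; rewrite !inE.
  - by move=> t; rewrite inE.
apply: (perfect_code_of_transversal pT); apply/subsetP=> y yG.
apply/negPn/negP=> yHT.
have missed z s : z \notin H * T -> s \in H :* z -> s \notin H * T.
  move=> zHT /rcosetP[a aH ->]; apply: contra zHT => /mulsgP[b t bH tT azE].
  by rewrite -[z](mulKg a) azE mulgA mem_mulg ?groupM ?groupV.
(* By maximality, no enlargement of T is possible. *)
have noext s : s \in G -> s \notin H * T -> s^-1 \notin H * T ->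
  ~ (s^-1 = s \/ s^-1 \notin H :* s).
- move=> sG sHT sVHT sVs; case/negP: (sHT).
  have := maxT _ (inv_partial_transversalU pT sG sHT sVHT sVs) (subsetUl _ _).
  by move=> TE; rewrite -[s]mul1g mem_mulg // -TE !inE eqxx orbT.
(* An element a y b of square 1 is conjugate to b a y, which is in H y. *)
have noinv s : s \in H :* y * H -> s ^+ 2 != 1.
  case/dcosetP=> a [b [aH bH ->]]; apply/eqP=> s2.
  have uE : b * a * y = (a * y * b) ^ b^-1 by rewrite conjgE invgK !mulgA mulgK.
  have uV : (b * a * y)^-1 = b * a * y.
    by apply/eqP; rewrite eq_invg_mul -expg2 uE -conjXg s2 conj1g.
  have uHT : b * a * y \notin H * T.
    by apply: (missed y) => //; rewrite mem_rcoset mulgK groupM.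
  apply: (noext (b * a * y)); rewrite ?uV //; last by left.
  by rewrite groupM // (subsetP sHG) ?groupM.
have [z [zDV zHT zy]] := missed_rcoset pT yG yHT noinv.
have [s sy sVz] := dcoset_inv_rcoset zDV.
apply: (noext s).
- by case/rcosetP: sy => a aH ->; rewrite groupM // (subsetP sHG).
- exact: missed sy.
- exact: missed sVz.
right; apply: contra zy => sVs.
by rewrite rcoset_sym in sVz; apply: rcoset_trans sVz (rcoset_trans sVs sy).
Qed.

End PartialTransversals.

(** * Elements with square in the subgroup *)

Section SquaresInSubgroup.

Variables (gT : finGroupType) (G H : {group gT}).
Hypothesis sHG : H \subset G.

(** The element of S joining x to its neighbour in H is x^-1 up to a factor
    in H, and its inverse joins x to a vertex of H as well; by uniqueness it
    is its own inverse. *)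
Lemma perfect_code_normalizer x : perfect_code G H ->
  x \in 'N_G(H) -> x ^+ 2 \in H -> exists2 h, h \in H & (x * h) ^+ 2 = 1.
Proof.
case=> S [[_ SV] [_ _ code1]] /setIP[xG xN] x2.
have [xH | xH] := boolP (x \in H).
  by exists x^-1; rewrite ?groupV // mulgV expg1n.
have /eqP/cards1P[c /setP cE] := code1 x (introT setDP (conj xG xH)).
have {}cE d : (d \in H) && (d * x^-1 \in S) = (d == c).
  by have := cE d; rewrite !inE.
have /andP[cH cS] : (c \in H) && (c * x^-1 \in S) by rewrite cE.
(* x c^-1 x is the element d of H for which d x^-1 is the inverse of c x^-1;
   both lie in S, so d = c. *)
have sV : x * c^-1 * x = c.
  apply/eqP; rewrite -cE mulgK -SV inE invMg invgK cS andbT.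
  have -> : x * c^-1 * x = (c^-1 ^ x^-1) * x ^+ 2.
    by rewrite conjgE invgK expgS expg1 !mulgA mulgKV.
  by rewrite groupM // memJ_norm ?groupV.
exists c^-1; first by rewrite groupV.
by rewrite expgS expg1 !mulgA sV mulgV.
Qed.

(** The square of y ^+ #|H| is (y ^+ 2) ^+ #|H| = 1, and an odd power of y is
    in H y because y^2 is in H. *)
Lemma odd_order_square y : odd #|H| -> y ^+ 2 \in H ->
  exists2 s, s \in H :* y & s ^+ 2 = 1.
Proof.
move=> oddH y2; exists (y ^+ #|H|).
  rewrite -(odd_double_half #|H|) oddH add1n expgSr -mul2n expgM.
  by rewrite mem_rcoset mulgK groupX.
by rewrite -expgM mulnC expgM expg_cardG.
Qed.

(** The subgroup I = H :&: H^y is normalised by y, because conjugation by y^2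
    fixes H, and it has odd index in G; so the image of y in N(I) / I, whose
    square is trivial, is trivial. *)
Lemma odd_index_square y : y \in G -> y ^+ 2 \in H ->
  odd #|G : H| -> odd #|H : H :&: H :^ y| -> y \in H.
Proof.
move=> yG y2 oddGH oddHI; set I := (H :&: H :^ y)%G.
have yN : y \in 'N(I).
  by apply/normP; rewrite /= conjIg -conjsgM -expg2 (conjGid y2) setIC.
have sIG : I \subset G by rewrite subIset ?sHG.
have oddGI : odd #|G : I|.
  by rewrite -(Lagrange_index sHG) ?subsetIl // oddM oddGH.
have y2I : y ^+ 2 \in I.
  by rewrite inE y2 -[y in y ^+ 2](mulKg y) -conjgE -conjXg memJ_conjg.
suff /eqP yI : coset I y == 1.
  by have := coset_idr yN yI; case/setIP.
have yNG : coset I y \in 'N_G(I) / I by rewrite mem_quotient // inE yG.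
rewrite -[coset I y]expg1 -order_dvdn.
have /eqP <- : coprime 2 #|G : I| by rewrite coprime2n.
rewrite dvdn_gcd order_dvdn -morphX //= (coset_id y2I) eqxx /=.
apply: dvdn_trans (order_dvdG yNG) _.
rewrite card_quotient ?subsetIr // indexSg ?subsetIl //.
by rewrite subsetI sIG normG.
Qed.

(** The index divides a power of 2, so it is 1 and H is contained in H^y. *)
Lemma odd_index_2group_norm y : 2.-group H ->
  odd #|H : H :&: H :^ y| -> y \in 'N(H).
Proof.
move=> H2 oddI.
have /eqP : #|H : H :&: H :^ y| = 1%N.
  apply: (@pnat_1 2); last by rewrite -odd_2'nat.
  exact: pnat_dvd (dvdn_indexg _ _) H2.
rewrite indexg_eq1 subsetI subxx /= => sHHy.
by apply/normP/eqP; rewrite eq_sym eqEcard sHHy cardJg /=.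
Qed.

End SquaresInSubgroup.

Unset Implicit Arguments.
Set Strict Implicit.

Theorem corollary3p3 (gT : finGroupType) (G H : {group gT})
    (sHG : H \subset G)
    (hyp : 2.-group H \/ (odd #|H| \/ odd #|G : H|)) :
  perfect_code G H <->
  (forall x : gT, x \in 'N_G(H) -> x ^+ 2 \in H ->
     exists2 h : gT, h \in H & (x * h) ^+ 2 = 1).
Proof.
split=> [codeH x | normH]; first exact: perfect_code_normalizer.
apply: perfect_code_of_dcoset_involutions => // y yG y2 oddI.
have [H2 | [oddH | oddGH]] := hyp.
- have yN : y \in 'N_G(H) by rewrite inE yG odd_index_2group_norm.
  have [h hH yh2] := normH y yN y2; exists (y * h) => //.
  by rewrite mem_mulg ?rcoset_refl.
- have [s sy s2] := odd_order_square oddH y2; exists s => //.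
  exact: (subsetP (rcoset_sub_dcoset H y)).
- have yH := odd_index_square sHG yG y2 oddGH oddI; exists 1.
    by rewrite rcoset_id // mulGid group1.
  by rewrite expg1n.
Qed.
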